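(* Let $\kappa$ be a Mahlo cardinal and let $\lambda,\lambda'$ be cardinals with $\kappa\le\lambda<\lambda'$. Suppose $S\subseteq\mathcal{P}_\kappa\lambda$. If $S\uparrow\lambda'$ is $2$-stationary in $\mathcal{P}_\kappa\lambda'$, then $S$ is $2$-stationary in $\mathcal{P}_\kappa\lambda$.
   Context: For a set $A$, $\mathcal{P}_\kappa A=\{x\subseteq A:|x|<\kappa\}$. A weakly inaccessible cardinal is an uncountable regular limit cardinal. A Mahlo cardinal is a strongly inaccessible cardinal in which the set of smaller inaccessible cardinals is stationary. Definition of $n$-stationarity, by recursion on $n<\omega$, simultaneously for all weakly inaccessible cardinals $\kappa$ and all sets $A\supseteq\kappa$: - $S\subseteq\mathcal{P}_\kappa A$ is $0$-stationary in $\mathcal{P}_\kappa A$ if it is unbounded, i.e. for every $x\in\mathcal{P}_\kappa A$ there is $y\in S$ with $x\subseteq y$. - For $n>0$, $S\subseteq\mathcal{P}_\kappa A$ is $n$-stationary in $\mathcal{P}_\kappa A$ if for all $m<n$ and all $m$-stationary $T\subseteq\mathcal{P}_\kappa A$ there is $x\in S$ such that $\mu:=x\cap\kappa$ is a weakly inaccessible cardinal and $T\cap\mathcal{P}_\mu x$ is $m$-stationary in $\mathcal{P}_\mu x$. For $\kappa\subseteq A\subseteq B$ and $S\subseteq\mathcal{P}_\kappa A$, $S\uparrow B:=\{y\in\mathcal{P}_\kappa B: y\cap A\in S\}$; here $S\uparrow\lambda'$ is taken with $A=\lambda$, $B=\lambda'$. *)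

(* Defs.v *)
From mathcomp Require Import all_boot all_order.
From mathcomp Require Import boolp classical_sets functions cardinality wochoice.

Set Implicit Arguments.
Unset Strict Implicit.
Unset Printing Implicit Defensive.

Import Order.TTheory.
Local Open Scope classical_set_scope.
Local Open Scope card_scope.
Local Open Scope order_scope.

(* Ordinals are the points of an arbitrary well-ordered type O, and a point a
   is identified, as a von Neumann ordinal, with the set [below a] of its
   predecessors. The well-ordering of O is a hypothesis of the theorem. *)

Definition card_lt {T U : Type} (A : set T) (B : set U) : Prop :=
  A #<= B /\ ~ (B #<= A).

Section Ordinals.
Context {d : Order.disp_t} {O : orderType d}.
Implicit Types (a b g k mu : O) (x A B X C : set O).

Definition below a : set O := [set b | b < a].

Definition is_cardinal k : Prop :=
  forall a, a < k -> ~ (below a #= below k).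

Definition regular k : Prop :=
  forall X, X `<=` below k ->
    (forall b, b < k -> exists2 a, X a & b <= a) -> ~ card_lt X (below k).

Definition limit_cardinal k : Prop :=
  is_cardinal k /\
  forall a, is_cardinal a -> a < k -> exists b, [/\ is_cardinal b, a < b & b < k].

Definition strong_limit_cardinal k : Prop :=
  is_cardinal k /\
  forall a, is_cardinal a -> a < k ->
    card_lt [set X : set O | X `<=` below a] (below k).

Definition weakly_inaccessible k : Prop :=
  [/\ limit_cardinal k, ~ countable (below k) & regular k].

Definition strongly_inaccessible k : Prop :=
  [/\ strong_limit_cardinal k, ~ countable (below k) & regular k].

Definition unbounded_below k X : Prop :=
  forall b, b < k -> exists a, [/\ X a, b < a & a < k].

(* A nonempty [below g] in which C is unbounded (in the strict sense above)
   is automatically a limit ordinal. *)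
Definition club k C : Prop :=
  [/\ C `<=` below k,
      unbounded_below k C &
      forall g, g < k -> below g !=set0 -> unbounded_below g C -> C g].

Definition stationary k X : Prop :=
  forall C, club k C -> (X `&` C) !=set0.

Definition mahlo k : Prop :=
  strongly_inaccessible k /\
  stationary k [set a | a < k /\ strongly_inaccessible a].

Definition Pk k A : set (set O) :=
  [set x | x `<=` A /\ card_lt x (below k)].

Definition unbounded_in k A (S : set (set O)) : Prop :=
  forall x, Pk k A x -> exists2 y, S y & x `<=` y.

(* [n' - j], for j : nat, ranges over exactly the m < n'.+1; this form is
   accepted as structurally decreasing. See [n_stationaryP]. *)
Fixpoint n_stationary (n : nat) k A (S : set (set O)) {struct n} : Prop :=
  match n with
  | 0 => unbounded_in k A S
  | n'.+1 =>
      forall (j : nat) (T : set (set O)),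
        T `<=` Pk k A -> n_stationary (n' - j)%N k A T ->
        exists x, S x /\
          exists mu, [/\ x `&` below k = below mu, weakly_inaccessible mu &
                        n_stationary (n' - j)%N mu x (T `&` Pk mu x)]
  end.

Lemma n_stationaryP (n : nat) k A (S : set (set O)) : (0 < n)%N ->
  n_stationary n k A S <->
  forall (i : nat) (T : set (set O)), (i < n)%N ->
    T `<=` Pk k A -> n_stationary i k A T ->
    exists x, S x /\
      exists mu, [/\ x `&` below k = below mu, weakly_inaccessible mu &
                    n_stationary i mu x (T `&` Pk mu x)].
Proof.
case: n => // n _; split=> H.
  by move=> i T; rewrite ltnS => le_in; have := H (n - i)%N T; rewrite subKn.
by move=> j T; apply: H; rewrite ltnS leq_subr.
Qed.

Definition uplift k A B (S : set (set O)) : set (set O) :=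
  [set y | Pk k B y /\ S (y `&` A)].

End Ordinals.

(* Main.v *)
(** Stationarity is projected and lifted between P_kappa lambda and
    P_kappa lambda'. Projection only restricts sets to lambda. The point is that
    the lift of a 1-stationary T is again 1-stationary. Given an unbounded U in
    P_kappa lambda', choose f with x <= f x in U, and call w closed if its trace
    on kappa is a cardinal nu and w contains f u, with |f u| < nu, for every
    u in P_nu w. Since kappa is Mahlo, an increasing continuous chain of length
    kappa meets its own height at an inaccessible nu, so closed sets are
    unbounded, and so are their traces on lambda. Reflecting the set of traces
    at some x in T with x /\ kappa = mu, the least closed sets with traces
    t in P_mu x depend monotonically on t; their union has trace x, and it is
    closed under f on its subsets of size < mu, hence U reflects to it. *)

Require Import Defs.
From mathcomp Require Import all_boot all_order.
From mathcomp Require Import boolp classical_sets functions cardinality wochoice.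

Set Implicit Arguments.
Unset Strict Implicit.
Unset Printing Implicit Defensive.

Import Order.TTheory.
Local Open Scope order_scope.
Local Open Scope classical_set_scope.
Local Open Scope card_scope.

(** * Cardinal comparison between sets over arbitrary types *)

Lemma rel_card_le {T U : Type} (A : set T) (B : set U) (R : T -> U -> Prop) :
  (forall a, A a -> exists2 b, B b & R a b) ->
  (forall a a' b, A a -> A a' -> R a b -> R a' b -> a = a') -> A #<= B.
Proof.
move=> Rtot Rinj.
(* An empty [U] forces [A] to be empty; otherwise a point of [U] serves as the value outside [A]. *)
elim/Ppointed: U => U in B R Rtot Rinj *.
  suff -> : A = set0 by exact: card_ge0.
  by apply/seteqP; split=> // a /Rtot[b]; case: (no b).
have {}Rtot a : exists b, A a -> B b /\ R a b.
  have [/Rtot[b Bb Rb]|nA] := pselect (A a); first by exists b.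
  by exists point.
have [f fP] := choice Rtot.
apply/pcard_leP/injfunPex; exists f; first by move=> a /fP[].
move=> a a' /set_mem Aa /set_mem Aa' ff; apply: (Rinj a a' (f a)) => //.
  exact: (fP a Aa).2.
by rewrite ff; exact: (fP a' Aa').2.
Qed.

Lemma card_le_fun {T U : Type} (A : set T) (B : set U) (u0 : U) : A #<= B ->
  exists f : T -> U, (forall a, A a -> B (f a)) /\
    (forall a a', A a -> A a' -> f a = f a' -> a = a').
Proof.
elim/Ppointed: U => U in B u0 *; first by case: (no u0).
move=> /pcard_leP/injfunPex[f fB finj]; exists f; split=> // a a' Aa Aa' ff.
by apply: finj; rewrite ?inE.
Qed.

Lemma card_le_surj_fun {T U : Type} (A : set T) (B : set U) (t0 : T) : A #<= B ->
  exists g : U -> T, forall a, A a -> exists2 b, B b & g b = a.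
Proof.
elim/Ppointed: T => T in A t0 *; first by case: (no t0).
by move=> /pcard_surjP[g gP]; exists g => a /gP[b Bb <-]; exists b.
Qed.

(* A partial injection from A to B maximal under inclusion exhausts A or B. *)
Lemma card_le_total {T U : Type} (A : set T) (B : set U) : A #<= B \/ B #<= A.
Proof.
pose P (F : set (T * U)) := (forall p, F p -> A p.1 /\ B p.2) /\
  (forall p q, F p -> F q -> p.1 = q.1 <-> p.2 = q.2).
have [F FP Ftot|F [[FAB Finj] Fmax]] := @Zorn_bigcup _ P.
  split=> [p [X FX Xp]|p q [X FX Xp] [Y FY Yq]]; first exact: (FP _ FX).1.
  by case: (Ftot _ _ FX FY) => XY; [apply: (FP _ FY).2 => //; apply: XY
    | apply: (FP _ FX).2 => //; apply: XY].
have [AF|] := pselect (forall a, A a -> exists b, F (a, b)).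
  left; apply: (@rel_card_le _ _ _ _ (fun a b => F (a, b))).
    by move=> a /AF[b Fab]; exists b => //; case: (FAB _ Fab).
  by move=> a a' b _ _ Fa Fa'; apply: (Finj _ _ Fa Fa').2.
move=> /existsNP[a /not_implyP[Aa /forallNP na]].
have [BF|] := pselect (forall b, B b -> exists a, F (a, b)).
  right; apply: (@rel_card_le _ _ _ _ (fun b a => F (a, b))).
    by move=> b /BF[a' Fab]; exists a' => //; case: (FAB _ Fab).
  by move=> b b' a' _ _ Fb Fb'; apply: (Finj _ _ Fb Fb').1.
move=> /existsNP[b /not_implyP[Bb /forallNP nb]]; exfalso.
apply: (Fmax (F `|` [set (a, b)])).
  split; first by move=> p Fp; left.
  by move=> /(_ (a, b) (or_intror erefl)); apply: na.
split=> [p [/FAB//|->//]|p q].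
have new r : F r -> r.1 <> a /\ r.2 <> b.
  by case: r => r1 r2 Fr /=; split=> e; [apply: (na r2)|apply: (nb r1)];
    rewrite -e.
move=> [Fp|->] [Fq|->] //=.
- exact: Finj.
- by have [? ?] := new _ Fp; split.
- by have [n1 n2] := new _ Fq; split=> e; [case: n1|case: n2].
Qed.

Lemma card_ltNge {T U : Type} (A : set T) (B : set U) :
  ~ (B #<= A) -> card_lt A B.
Proof. by move=> nBA; split=> //; case: (card_le_total A B). Qed.

Lemma card_le_lt_trans {T U V : Type} (A : set T) (B : set U) (C : set V) :
  A #<= B -> card_lt B C -> card_lt A C.
Proof.
move=> AB [BC nCB]; split; first exact: card_le_trans BC.
by move=> CA; apply: nCB; exact: card_le_trans AB.
Qed.

Lemma card_lt_le_trans {T U V : Type} (A : set T) (B : set U) (C : set V) :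
  card_lt A B -> B #<= C -> card_lt A C.
Proof.
move=> [AB nBA] BC; split; first exact: card_le_trans BC.
by move=> CA; apply: nBA; exact: card_le_trans CA.
Qed.

Lemma countable_card_lt {T U : Type} (A : set T) (B : set U) :
  countable A -> ~ countable B -> card_lt A B.
Proof.
by move=> cA ncB; apply: card_ltNge => BA; apply: ncB; exact: sub_countable cA.
Qed.

Lemma card_le_powerset {T U : Type} (A : set T) (B : set U) (u0 : U) :
  A #<= B -> [set X : set T | X `<=` A] #<= [set Y : set U | Y `<=` B].
Proof.
move=> /(card_le_fun u0)[f [fB finj]].
apply: (@rel_card_le _ _ _ _ (fun X Y => Y = f @` X)) => [X XA|X Y _ XA YA -> e].
  by exists (f @` X) => // _ [a Xa <-]; apply/fB/XA.
have sub V W : V `<=` A -> W `<=` A -> f @` V = f @` W -> V `<=` W.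
  move=> VA WA VW a Va; have : (f @` W) (f a) by rewrite -VW; exists a.
  by move=> [b Wb /finj <-] //; [exact: WA|exact: VA].
by apply/seteqP; split; apply: sub.
Qed.

(** * Well-founded minima and the arithmetic of regular cardinals *)

Section Regular.
Context {d : Order.disp_t} {O : orderType d}.
Hypothesis O_wo : well_order (@Order.le d O).
Implicit Types (a b c k l mu nu : O) (x y z t u v w A B X C : set O).

Lemma least_ex (P : set O) : P !=set0 ->
  exists2 a, P a & forall b, P b -> a <= b.
Proof.
move=> [a Pa]; have [|z [[zP lbz] _]] := O_wo (A := [pred b | `[< P b >]]).
  by exists a; apply/asboolP.
by exists z => [|b Pb]; [exact/asboolP|apply: lbz; exact/asboolP].
Qed.

Lemma wo_ind (P : O -> Prop) :
  (forall a, (forall b, b < a -> P b) -> P a) -> forall a, P a.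
Proof.
move=> IH; apply: contrapT => /existsNP[a nPa].
have [m nPm lem] := @least_ex [set b | ~ P b] (ex_intro _ a nPa).
apply: nPm; apply: IH => b bm; apply: contrapT => nPb.
by have := lem b nPb; rewrite leNgt bm.
Qed.

Lemma card_le_below a b : a <= b -> below a #<= below b.
Proof. by move=> ab; apply: subset_card_le => c /= /lt_le_trans; apply. Qed.

Lemma sub_below_le a b : below a `<=` below b -> a <= b.
Proof. by move=> ab; rewrite leNgt; apply/negP => /ab; rewrite /below /= ltxx. Qed.

Lemma cardinal_lt_card k a : is_cardinal k -> a < k ->
  card_lt (below a) (below k).
Proof.
move=> kc ak; split; first exact/card_le_below/ltW.
move=> ka; apply: (kc a ak); apply/card_eqPle; split=> //.
exact/card_le_below/ltW.
Qed.

Lemma regular_bounded k X : regular k -> X `<=` below k ->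
  card_lt X (below k) -> exists2 b, b < k & forall a, X a -> a < b.
Proof.
move=> kr Xk ltX; apply: contrapT => nb; apply: (kr X Xk _ ltX) => b bk.
apply: contrapT => nX; apply: nb; exists b => // a Xa; rewrite ltNge.
by apply/negP => ba; apply: nX; exists a.
Qed.

(** Regularity bounds an injective copy of [V] in [below k]; the least point whose predecessors can
    still accommodate [V] must be a cardinal. *)
Lemma regular_cardinal_bound {T : Type} k (V : set T) : regular k ->
  card_lt V (below k) ->
  exists a, [/\ is_cardinal a, a < k & V #<= below a].
Proof.
move=> kr ltV; have [f [fk finj]] := card_le_fun k ltV.1.
have fV : f @` V #= V.
  by apply: inj_card_eq => a a' /set_mem ? /set_mem ?; exact: finj.
have [||b bk fb] := @regular_bounded k (f @` V) kr.
- by move=> _ [a Va <-]; exact: fk.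
- by apply: card_le_lt_trans ltV; have /card_eqPle[] := fV.
have Vb : V #<= below b.
  have /card_eqPle[_ h] := fV; apply: (card_le_trans h).
  by apply: subset_card_le => a; exact: fb.
have [a Va amin] := @least_ex [set a | V #<= below a] (ex_intro _ b Vb).
exists a; split=> //; last exact: le_lt_trans (amin b Vb) bk.
move=> c ca /card_eqPle[_ ac].
by have := amin c (card_le_trans Va ac); rewrite leNgt ca.
Qed.

(* A map of the union onto [below k] would be bounded on each piece, hence
   bounded. *)
Lemma regular_bigcup {I T : Type} k (D : set I) (F : I -> set T) : regular k ->
  ~ countable (below k) ->
  card_lt D (below k) -> (forall i, D i -> card_lt (F i) (below k)) ->
  card_lt (\bigcup_(i in D) F i) (below k).
Proof.
move=> kr kunc ltD ltF; apply: card_ltNge.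
move=> /(card_le_surj_fun k)[g gP].
have bnd i : exists b, D i ->
    b < k /\ forall e, F i e -> g e < k -> g e < b.
  have [Di|] := pselect (D i); last by exists k.
  have [||b bk gb] := @regular_bounded k (g @` F i `&` below k) kr.
  - by move=> ? [].
  - apply: card_le_lt_trans (ltF i Di).
    by apply: card_le_trans (card_image_le g _); apply: subset_card_le => ? [].
  by exists b => _; split=> // e Fe ge; apply: gb; split=> //; exists e.
have [h hP] := choice bnd.
have [||b bk hb] := @regular_bounded k (h @` D) kr.
- by move=> _ [i Di <-]; exact: (hP i Di).1.
- exact: card_le_lt_trans (card_image_le h _) ltD.
have [e [i Di Fe] ge] := gP b bk.
have := (hP i Di).2 e Fe; rewrite ge => /(_ bk); apply/negP.
by rewrite -leNgt; apply/ltW/hb; exists i.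
Qed.

Lemma regular_setU {T : Type} k (V V' : set T) : regular k ->
  ~ countable (below k) -> card_lt V (below k) -> card_lt V' (below k) ->
  card_lt (V `|` V') (below k).
Proof.
move=> kr kunc ltV ltV'.
have -> : V `|` V' = \bigcup_(i in [set: bool]) (if i then V else V').
  apply/seteqP; split=> [e [Ve|Ve]|e [[] _ Ve]]; [|by exists false|by left|by right].
  by exists true.
by apply: regular_bigcup => // [|[]//]; apply: countable_card_lt.
Qed.

Lemma strong_limit_powerset {T : Type} k (V : set T) : strong_limit_cardinal k ->
  regular k -> card_lt V (below k) ->
  card_lt [set X : set T | X `<=` V] (below k).
Proof.
move=> [_ ksl] kr /(regular_cardinal_bound kr)[a [ac ak Va]].
exact: card_le_lt_trans (card_le_powerset a Va) (ksl a ac ak).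
Qed.

(** There is no largest predecessor, because a singleton is too small to be cofinal in an
    uncountable regular [k]. *)
Lemma regular_succ k a : regular k -> ~ countable (below k) -> a < k ->
  exists2 b, b < k & a < b.
Proof.
move=> kr kunc ak; have [||b bk ab] := @regular_bounded k [set a] kr.
- by move=> _ ->.
- exact: countable_card_lt (@countable1 _ a) kunc.
by exists b => //; exact: ab.
Qed.

End Regular.

(** * Continuous chains of stages, and unboundedness of the closed sets *)

Section Stages.
Context {d : Order.disp_t} {O : orderType d}.
Hypothesis O_wo : well_order (@Order.le d O).
Implicit Types (a b c g k nu : O) (x y u v w A : set O).

(** Transfinite recursion along the height [a], encoded as an inductive predicate. Requiring [u] to
    lie in one earlier stage [c] makes the chain continuous at limit heights. *)
Inductive stage x0 (G : set O -> set O) : O -> set O :=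
| stage_base a b : x0 b -> stage x0 G a b
| stage_below a b : b < a -> stage x0 G a b
| stage_step a c u b : c < a -> u `<=` stage x0 G c -> G u b -> stage x0 G a b.

Lemma stageE x0 G a : stage x0 G a =
  x0 `|` below a `|`
  \bigcup_(c in below a) \bigcup_(u in [set u | u `<=` stage x0 G c]) G u.
Proof.
apply/seteqP; split=> b.
  case=> [{}a {}b ?|{}a {}b ?|{}a c u {}b ca uc Gb];
    [by left; left|by left; right|].
  by right; exists c => //; exists u.
move=> [[xb|ba]|[c ca [u uc Gb]]]; [exact: stage_base|exact: stage_below|].
exact: stage_step ca uc Gb.
Qed.

Lemma stage_mono x0 G a b : a <= b -> stage x0 G a `<=` stage x0 G b.
Proof.
move=> ab e; rewrite stageE => -[[xe|ea]|[c ca [u uc Ge]]].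
- exact: stage_base.
- exact/stage_below/(lt_le_trans ea).
- exact: stage_step (lt_le_trans ca ab) uc Ge.
Qed.

Lemma stage_sub x0 G A a : x0 `<=` A -> below a `<=` A ->
  (forall u, G u `<=` A) -> stage x0 G a `<=` A.
Proof.
move=> xA aA GA b; rewrite stageE => -[[/xA//|/aA//]|[c _ [u _]]]; exact: GA.
Qed.

Section InaccessibleHeight.
Variables (k : O) (x0 : set O) (G : set O -> set O).
Hypothesis k_inacc : strongly_inaccessible k.
Hypothesis x0_small : card_lt x0 (below k).
Hypothesis G_small : forall u, card_lt (G u) (below k).

(** By induction on the height: the strong limit property leaves fewer than [k] subsets [u] of each
    earlier stage, and regularity handles the unions. *)
Lemma stage_small a : a < k -> card_lt (stage x0 G a) (below k).
Proof.
have [ksl kunc kr] := k_inacc.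
elim/(wo_ind O_wo): a => a IH ak; rewrite stageE.
have lta : card_lt (below a) (below k) by exact: cardinal_lt_card ksl.1 ak.
apply: regular_setU => //; first exact: regular_setU.
apply: regular_bigcup => // c ca; apply: regular_bigcup => //.
by apply: strong_limit_powerset => //; apply: IH => //; apply: lt_trans ak.
Qed.

(** These are the heights at which the chain meets its own height. Unboundedness iterates a bounding
    function countably often; closedness holds because a step into stage [g] starts from some
    [c < g]. *)
Lemma club_stage :
  club k [set g | g < k /\ stage x0 G g `&` below k `<=` below g].
Proof.
have [ksl kunc kr] := k_inacc.
split; first by move=> g [].
- move=> b0 b0k.
  have next a : exists e, a < k ->
      [/\ e < k, a < e & stage x0 G a `&` below k `<=` below e].
    have [ak|] := pselect (a < k); last by exists a.
    have [||e ek eP] := @regular_bounded _ _ k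
      ((stage x0 G a `&` below k) `|` [set a]) kr.
    - by move=> b [[]//|->].
    - apply: regular_setU => //; last exact: countable_card_lt (@countable1 _ a) kunc.
      apply: card_le_lt_trans (stage_small ak).
      by apply: subset_card_le => ? [].
    by exists e => _; split=> // [|b sb]; apply: eP; [right|left].
  have [e eP] := choice next; pose s n := iter n e b0.
  have sk n : s n < k by elim: n => [//|n IH] /=; have [] := eP _ IH.
  have [||g0 g0k g0P] := @regular_bounded _ _ k (range s) kr.
  - by move=> _ [n _ <-]; exact: sk.
  - apply: countable_card_lt kunc; exact: card_image_le.
  (* The least strict bound of the sequence is needed: any [c < g] then lies below some [s n]. *)
  have [g gP gmin] := @least_ex _ _ O_wo [set g | forall n, s n < g]
    (ex_intro _ g0 (fun n => g0P _ (ex_intro2 _ _ n I erefl))).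
  have gk : g < k by apply: le_lt_trans (gmin g0 _) g0k => n; apply: g0P; exists n.
  exists g; split=> //; last exact: (gP 0%N).
  have lt_s n b : stage x0 G (s n) b -> b < k -> b < g.
    move=> sb bk; have [_ _ h] := eP _ (sk n).
    by apply: lt_trans (gP n.+1); apply: h.
  split=> // b [+ bk]; rewrite stageE => -[[xb|//]|[c cg [u uc Gb]]].
    by apply: (lt_s 0%N) => //; apply: stage_base.
  have [n cn] : exists n, c < s n.
    apply: contrapT => /forallNP nc.
    suff : g <= c by rewrite leNgt cg.
    apply: gmin => n; have [_ h _] := eP _ (sk n).
    by apply: lt_le_trans h _; rewrite leNgt; apply/negP/(nc n.+1).
  by apply: (lt_s n) => //; apply: stage_step cn uc Gb.
- move=> g gk [c0 c0g] gP; split=> // b [+ bk].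
  rewrite stageE => -[[xb|//]|[c cg [u uc Gb]]].
    have [a [[_ aP] _ ag]] := gP c0 c0g.
    by apply: lt_trans ag; apply: aP; split=> //; apply: stage_base.
  have [a [[_ aP] ca ag]] := gP c cg.
  by apply: lt_trans ag; apply: aP; split=> //; apply: stage_step ca uc Gb.
Qed.

End InaccessibleHeight.

(** Each point of [u] enters at some height below [nu], and regularity of [nu] bounds fewer than
    [nu] such heights. *)
Lemma stage_compact x0 G nu u : regular nu -> ~ countable (below nu) ->
  u `<=` stage x0 G nu -> card_lt u (below nu) ->
  exists2 c, c < nu & u `<=` stage x0 G c.
Proof.
move=> nur nuunc usub ltu.
have rk b : exists a, u b -> a < nu /\ stage x0 G a b.
  have [/usub|] := pselect (u b); last by exists nu.
  rewrite stageE => -[[xb|bnu]|[c cnu [v vc Gb]]].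
  - have [a [an _]] : exists a, a < nu /\ True.
      apply: contrapT => /forallNP h; apply: nuunc.
      have -> : below nu = set0; last exact: countable0.
      by apply/seteqP; split=> // a an; apply: (h a).
    by exists a => _; split=> //; apply: stage_base.
  - have [a an ba] := regular_succ nur nuunc bnu.
    by exists a => _; split=> //; apply: stage_below.
  - have [a an ca] := regular_succ nur nuunc cnu.
    by exists a => _; split=> //; apply: stage_step ca vc Gb.
have [r rP] := choice rk.
have [||c cn rc] := @regular_bounded _ _ nu (r @` u) nur.
- by move=> _ [b ub <-]; have [] := rP b ub.
- exact: card_le_lt_trans (card_image_le r _) ltu.
exists c => // b ub; have [_ sb] := rP b ub.
by apply: stage_mono sb; apply/ltW/rc; exists b.
Qed.

(** [nu] is the height of [w]. The bound on the size of [f u] is what later puts [f u] into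
    [Pk mu y]. *)
Definition closed_under (f : set O -> set O) k A w : Prop :=
  Pk k A w /\ exists nu, [/\ is_cardinal nu, w `&` below k = below nu &
    forall u, u `<=` w -> card_lt u (below nu) ->
      f u `<=` w /\ card_lt (f u) (below nu)].

Lemma closed_under_unbounded (f : set O -> set O) k A : mahlo k ->
  below k `<=` A -> (forall u, Pk k A (f u)) ->
  unbounded_in k A (closed_under f k A).
Proof.
move=> [kin kst] kA fP x0 [x0A x0k].
have [ksl kunc kr] := kin.
have bnd u : exists c, [/\ is_cardinal c, c < k & f u #<= below c].
  exact: (regular_cardinal_bound O_wo kr (fP u).2).
have [c cP] := choice bnd.
(* Adjoining the cardinal [c u], which bounds the size of [f u], forces [c u < nu] at a height [nu]
   where the trace is [below nu]; hence [f u] has size less than [nu]. *)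
pose G u := f u `|` [set c u].
have Gsmall u : card_lt (G u) (below k).
  apply: regular_setU => //; first exact: (fP u).2.
  exact: countable_card_lt (@countable1 _ (c u)) kunc.
have [nu [[nuk [[nuc _] nuunc nur]] [_ snu]]] := kst _ (club_stage kin x0k Gsmall).
have snuE : stage x0 G nu `&` below k = below nu.
  apply/seteqP; split=> // b bnu; split; first exact: stage_below.
  exact: lt_trans nuk.
exists (stage x0 G nu); last by move=> b; apply: stage_base.
split; [split; last exact: (stage_small kin)|].
  apply: stage_sub => //; first by move=> b bnu; apply/kA/(lt_trans bnu).
  by move=> u b [/(fP u).1//|->]; apply: kA; have [] := cP u.
exists nu; split=> // u usub ltu.
have [e en ue] := stage_compact nur nuunc usub ltu.
split=> [b fb|]; first by apply: stage_step en ue _; left.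
have [_ ck fc] := cP u; apply: card_le_lt_trans fc _.
apply: cardinal_lt_card nuc _.
suff : below nu (c u) by [].
by rewrite -snuE; split=> //; apply: stage_step en ue _; right.
Qed.

End Stages.

(** * Passage of unboundedness and 1-stationarity between [A] and [B] *)

Section Projection.
Context {d : Order.disp_t} {O : orderType d}.
Hypothesis O_wo : well_order (@Order.le d O).
Implicit Types (a b c g k mu nu : O) (t x y u v w A B : set O) (S T U : set (set O)).

(* The intersections in [uplift] and [n_stationary] are the meet of the lattice
   of sets; the next two lemmas restate these notions with [setI]. *)
Lemma upliftP k A B S y : uplift k A B S y <-> Pk k B y /\ S (y `&` A).
Proof. by []. Qed.

Lemma n_stationary_setIP n k A S : (0 < n)%N ->
  n_stationary n k A S <->
  forall (i : nat) (T : set (set O)), (i < n)%N ->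
    T `<=` Pk k A -> n_stationary i k A T ->
    exists x, S x /\
      exists mu, [/\ x `&` below k = below mu, weakly_inaccessible mu &
                    n_stationary i mu x (T `&` Pk mu x)].
Proof. exact: n_stationaryP. Qed.

(** If [t] in [S] contains the trace of [x] on [A], then the union of [t] and [x] still has trace
    [t]. *)
Lemma unbounded_in_uplift k A B S : A `<=` B -> regular k ->
  ~ countable (below k) -> S `<=` Pk k A -> unbounded_in k A S ->
  unbounded_in k B (uplift k A B S).
Proof.
move=> AB kr kunc SA Sunb x [xB xk].
have [|t St xt] := Sunb (x `&` A).
  split; first by move=> ? [].
  by apply: card_le_lt_trans xk; apply: subset_card_le => ? [].
have [tA tk] := SA t St.
exists (t `|` x); last by move=> ? ?; right.
apply/upliftP; split.
  by split; [move=> b [/tA/AB|/xB]|exact: regular_setU].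
suff -> : (t `|` x) `&` A = t by [].
by apply/seteqP; split=> [b [[//|xb] Ab]|b tb]; [exact: xt|split; [left|exact: tA]].
Qed.

Lemma unbounded_in_trace k A B x mu U : A `<=` B -> x `<=` B ->
  unbounded_in mu x (uplift k A B U `&` Pk mu x) ->
  unbounded_in mu (x `&` A) (U `&` Pk mu (x `&` A)).
Proof.
move=> AB xB unb z [zx zmu].
have [|w [[_ Uw] [wx wmu]] zw] := unb z; first by split=> // b /zx[].
exists (w `&` A); last by move=> b zb; split; [exact: zw|have [] := zx b zb].
split=> //; split; first by move=> b [/wx].
by apply: card_le_lt_trans wmu; apply: subset_card_le => ? [].
Qed.

Lemma setI_below_sub k A y : below k `<=` A ->
  (y `&` A) `&` below k = y `&` below k.
Proof. by move=> kA; rewrite -setIA; congr (_ `&` _); apply/setIidr. Qed.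

(** A point of [S] reflecting the lift of an unbounded family has a trace reflecting the family
    itself. The final theorem applies this one level down, at [mu] instead of [kappa]. *)
Lemma n_stationary1_trace k A B S : below k `<=` A -> A `<=` B ->
  regular k -> ~ countable (below k) -> S `<=` Pk k B ->
  n_stationary 1 k B S -> n_stationary 1 k A [set y `&` A | y in S].
Proof.
move=> kA AB kr kunc SB /(n_stationary_setIP _ _ _ (ltn0Sn 0)) st.
apply/n_stationary_setIP => // -[|//] U _ UA Uunb.
have [|y [Sy [mu [ymu muw munb]]]] := st 0%N (uplift k A B U) isT _
    (unbounded_in_uplift AB kr kunc UA Uunb); first by move=> ? [].
exists (y `&` A); split; first by exists y.
exists mu; split=> //; first by rewrite setI_below_sub.
exact: unbounded_in_trace AB (SB y Sy).1 munb.
Qed.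

Lemma n_stationary1_sub k A S T : S `<=` T ->
  n_stationary 1 k A S -> n_stationary 1 k A T.
Proof.
move=> ST st j U UA Uunb; have [x [Sx xP]] := st j U UA Uunb.
by exists x; split=> //; exact: ST.
Qed.

(** * Least closed sets with a prescribed trace on [A] *)

Section Hull.
Variables (f : set O -> set O) (k : O) (A B : set O).
Hypothesis kA : below k `<=` A.

(** Meaningful for [t] in [closed_traces]; for other [t] the intersection is over an empty family
    and gives the full set. *)
Definition closed_hull t := \bigcap_(w in [set w | closed_under f k B w /\ w `&` A = t]) w.

Definition closed_traces : set (set O) := [set w `&` A | w in closed_under f k B].

Lemma closed_hull_trace t : closed_traces t -> closed_hull t `&` A = t.
Proof.
move=> [w wcl wt]; apply/seteqP; split=> [b [hb Ab]|b tb].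
  by rewrite -wt; split=> //; apply: hb.
split; first by move=> w' [_ w't]; move: tb; rewrite -w't => -[].
by move: tb; rewrite -wt => -[].
Qed.

(** The inclusion makes the height of [w] at most that of [w'], so a set small for [w] is small for
    [w'], and the intersection keeps the height of [w]. *)
Lemma closed_underI w w' : closed_under f k B w -> closed_under f k B w' ->
  w `&` A `<=` w' -> closed_under f k B (w `&` w').
Proof.
move=> [[wB wk] [nu [nuc wnu wcl]]] [_ [nu' [nuc' wnu' wcl']]] sub.
have nu_sub b : below nu b -> [/\ w b, w' b & below k b].
  by rewrite -wnu => -[wb bk]; split=> //; apply: sub; split=> //; apply: kA.
have nule : nu <= nu'.
  by apply: sub_below_le => b /nu_sub[_ ? ?]; rewrite -wnu'.
split.
  split; first by move=> b [/wB].
  by apply: card_le_lt_trans wk; apply: subset_card_le => ? [].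
exists nu; split=> //.
  by apply/seteqP; split=> [b [[wb _] bk]|b /nu_sub[]]; first by rewrite -wnu.
move=> u usub ltu; have [|fw fnu] := wcl u _ ltu; first by move=> b /usub[].
have [||fw' _] := wcl' u; first by move=> b /usub[].
  exact: card_lt_le_trans ltu (card_le_below nule).
by split=> // b fb; split; [exact: fw|exact: fw'].
Qed.

(** Intersecting a closed set of trace [t] with any competitor [w'] for [t'] gives a competitor for
    [t] inside [w']. *)
Lemma closed_hull_mono t t' : closed_traces t -> t `<=` t' -> closed_hull t `<=` closed_hull t'.
Proof.
move=> [w wcl wt] tt' b hb w' [w'cl w't'].
have sub : w `&` A `<=` w' by rewrite wt => c /tt'; rewrite -w't' => -[].
suff : (w `&` w') b by case.
apply: hb; split; first exact: closed_underI.
rewrite -wt; apply/seteqP; split=> [c [[wc _] Ac]//|c wc].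
by split; [split; [case: wc|exact: sub]|case: wc].
Qed.

(** All competitors share the trace [t], hence the same height, so their closure conditions hold for
    the same small sets [u] and pass to the intersection. *)
Lemma closed_hull_closed t : closed_traces t -> closed_under f k B (closed_hull t).
Proof.
move=> tt; have [w wcl wt] := tt.
have hw : closed_hull t `<=` w by move=> b; apply.
have [[wB wk] [nu [nuc wnu _]]] := wcl.
have tnu : t `&` below k = below nu by rewrite -wt setI_below_sub.
split.
  split; first exact: subset_trans hw wB.
  by apply: card_le_lt_trans wk; apply: subset_card_le.
exists nu; split=> //; first by rewrite -(setI_below_sub _ kA) closed_hull_trace.
move=> u uh ltu.
suff H w' : closed_under f k B w' -> w' `&` A = t ->
    f u `<=` w' /\ card_lt (f u) (below nu).
  by split; [move=> b fb w' [w'cl w't]; exact: (H w' w'cl w't).1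
    |exact: (H w wcl wt).2].
move=> w'cl w't; have := w'cl; move=> [_ [nu' [_ w'nu' cl]]].
have <- : below nu' = below nu by rewrite -tnu -w'nu' -w't setI_below_sub.
apply: cl; first by move=> b /uh; apply.
by rewrite -w'nu' -(setI_below_sub _ kA) w't tnu.
Qed.

End Hull.

Lemma n_stationary1_uplift k A B S : mahlo k -> below k `<=` A -> A `<=` B ->
  S `<=` Pk k A -> n_stationary 1 k A S ->
  n_stationary 1 k B (uplift k A B S).
Proof.
move=> kM kA AB SA /(n_stationary_setIP _ _ _ (ltn0Sn 0)) st.
have kB := subset_trans kA AB.
have [[ksl kunc kr] _] := kM.
apply/n_stationary_setIP => // -[|//] U _ UB Uunb.
have /choice[f fP] : forall u, exists y,
    Pk k B y /\ (Pk k B u -> U y /\ u `<=` y).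
  move=> u; have [uP|nuP] := pselect (Pk k B u).
    by have [y Uy uy] := Uunb u uP; exists y; split=> //; apply: UB.
  (* A harmless value outside [Pk k B], since [closed_under_unbounded] asks for every [f u] to be in
     [Pk k B]. *)
  exists set0; split=> //; split=> //.
  exact: countable_card_lt (@countable0 _) kunc.
have fB u : Pk k B (f u) by have [] := fP u.
have Wunb := closed_under_unbounded O_wo kM kB fB.
pose R := closed_traces f k A B.
have [||x [Sx [mu [xmu muw Rx]]]] := st 0%N R isT.
- move=> t [w [[wB wk] _] <-]; split; first by move=> ? [].
  by apply: card_le_lt_trans wk; apply: subset_card_le => ? [].
- move=> z [zA zk]; have [|w wcl zw] := Wunb z.
    by split=> //; apply: subset_trans AB.
  by exists (w `&` A); [exists w|move=> b zb; split; [exact: zw|exact: zA]].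
have [xA xk] := SA x Sx.
have [_ muunc mur] := muw.
pose D := R `&` Pk mu x; pose y := \bigcup_(t in D) closed_hull f k A B t.
have yA : y `&` A = x.
  apply/seteqP; split=> [b [[t [Rt [tx _]] hb] Ab]|b xb].
    by apply: tx; rewrite -(closed_hull_trace Rt).
  have [|t Dt bt] := Rx [set b].
    split; first by move=> _ ->.
    exact: countable_card_lt (@countable1 _ b) muunc.
  have tb : t b by exact: bt.
  have : (closed_hull f k A B t `&` A) b by rewrite (closed_hull_trace Dt.1).
  by move=> [hb Ab]; split=> //; exists t.
have yk : y `&` below k = below mu by rewrite -(setI_below_sub _ kA) yA.
have yB : Pk k B y.
  split; first by move=> b [t [Rt _]]; exact: (closed_hull_closed kA Rt).1.1.
  apply: regular_bigcup => // [|t [Rt _]]; last exact: (closed_hull_closed kA Rt).1.2.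
  (* The index family [D] consists of subsets of [x], so it has size less than [k] by the strong
     limit property. *)
  apply: card_le_lt_trans (strong_limit_powerset O_wo ksl kr xk).
  by apply: subset_card_le => t [_ []].
exists y; split; first by apply/upliftP; rewrite yA.
exists mu; split=> // u [uy ult].
have ht b : exists t, u b -> D t /\ closed_hull f k A B t b.
  have [/uy[t Dt hb]|] := pselect (u b); first by exists t.
  by exists set0.
have [t tP] := choice ht.
have [c [cc cmu uc]] := regular_cardinal_bound O_wo mur ult.
(* One trace [t'] above all chosen [t b] has a hull containing [u]. Putting [c] into it makes the
   height [nu] of the hull exceed [c], so [u] is small enough for its closure under [f]. *)
have [|t' [Rt' [t'x t'mu]] sub] := Rx (\bigcup_(b in u) t b `|` [set c]).
  split; first move=> e [[b ub tbe]|->].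
  - by have [[_ [tx _]] _] := tP b ub; apply: tx.
  - have : below mu c by []. by rewrite -xmu => -[].
  - apply: regular_setU => //; last exact: countable_card_lt (@countable1 _ c) muunc.
    apply: regular_bigcup => // b ub; by have [[_ []]] := tP b ub.
have [_ [nu [nuc hnu hcl]]] := closed_hull_closed kA Rt'.
have t'nu : t' `&` below k = below nu.
  by rewrite -hnu -[RHS](setI_below_sub _ kA) (closed_hull_trace Rt').
have numu : nu <= mu.
  by apply: sub_below_le; rewrite -t'nu -xmu => b [/t'x].
have cnu : c < nu.
  suff : below nu c by [].
  rewrite -t'nu; split; first by apply: sub; right.
  by have : below mu c by []; rewrite -xmu => -[].
have [||fh fnu] := hcl u.
- move=> b ub; have [[Rt _] hb] := tP b ub.
  by apply: (closed_hull_mono kA Rt) hb => e te; apply: sub; left; exists b.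
- exact: card_le_lt_trans uc (cardinal_lt_card nuc cnu).
have [|Uf uf] := (fP u).2.
  split; first exact: subset_trans uy yB.1.
  apply: card_lt_le_trans ult _; rewrite -yk; apply: card_le_trans yB.2.1.
  by apply: subset_card_le => ? [].
exists (f u) => //; split=> //; split; first by move=> b /fh hb; exists t'.
exact: card_lt_le_trans fnu (card_le_below numu).
Qed.

End Projection.

Theorem proposition4p8 (d : Order.disp_t) (O : orderType d)
    (O_wo : well_order (@Order.le d O))
    (kappa lambda lambda' : O)
    (kappa_mahlo : mahlo kappa)
    (lambda_card : is_cardinal lambda) (lambda'_card : is_cardinal lambda')
    (kappa_le_lambda : kappa <= lambda) (lambda_lt_lambda' : lambda < lambda')
    (S : set (set O)) (S_sub : S `<=` Pk kappa (below lambda)) :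
  n_stationary 2 kappa (below lambda')
    (uplift kappa (below lambda) (below lambda') S) ->
  n_stationary 2 kappa (below lambda) S.
Proof.
move=> /(n_stationary_setIP _ _ _ (ltn0Sn 1)) st.
have [[_ kunc kr] _] := kappa_mahlo.
have kl : below kappa `<=` below lambda by move=> b /lt_le_trans; apply.
have ll : below lambda `<=` below lambda' by move=> b /lt_trans; apply.
apply/n_stationary_setIP => // i T lti TA Tst.
have upT : n_stationary i kappa (below lambda')
    (uplift kappa (below lambda) (below lambda') T).
  (* Only the orders 0 and 1 occur below 2, and each has its own lifting lemma. *)
  case: i lti Tst => [|[|//]] _ Tst; first exact: unbounded_in_uplift.
  exact: n_stationary1_uplift.
have [|y [[[yl yk] Sy] [mu [ymu muw munst]]]] := st i _ lti _ upT.
  by move=> ? [].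
exists (y `&` below lambda); split=> //; exists mu.
split=> //; first by rewrite setI_below_sub.
case: i lti Tst upT munst => [|[|//]] _ _ _ munst.
  exact: unbounded_in_trace ll yl munst.
have [_ muunc mur] := muw.
have muy : below mu `<=` y by rewrite -ymu => ? [].
have muk : below mu `<=` below kappa by rewrite -ymu => ? [].
have muyl : below mu `<=` y `&` below lambda.
  by move=> b bmu; split; [exact: muy|exact/kl/muk].
have tr := n_stationary1_trace muyl (@subIsetl _ _ _) mur muunc
  (@subIsetr _ _ _) munst.
(* It remains to see that the traces lie in [T]: as [w] is contained in [y], its trace on the
   smaller set is its trace on [below lambda]. *)
apply: n_stationary1_sub tr.
move=> _ [w [[_ Tw] [wy wmu]] <-].
have -> : w `&` (y `&` below lambda) = w `&` below lambda.
  by rewrite setIA (setIidl wy).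
split=> //; split; first by move=> b [/wy].
by apply: card_le_lt_trans wmu; apply: subset_card_le => ? [].
Qed.
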